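(* Let $u,v\in\mathcal{F}(\mathbb{R})$ be fuzzy numbers and let $\alpha\in[0,1]$. Then the following hold. (i) If $u'_+(u^+(\alpha))=\varphi<0$ and $v'_+(v^+(\alpha))=\psi<0$, then $(u\nabla v)'_+((u\nabla v)^+(\alpha))=(\varphi^{-1}+\psi^{-1})^{-1}$. (ii) If $u'_-(u^+(\alpha))=\varphi<0$, $v'_-(v^+(\alpha))=\psi<0$, and $u(u^+(\alpha))=v(v^+(\alpha))=\beta$, then $(u\nabla v)'_-((u\nabla v)^+(\beta))=(\varphi^{-1}+\psi^{-1})^{-1}$. (iii) If $u'_-(u^+(\alpha))=\varphi$, $u(u^+(\alpha))=\beta$, and $v(v^+(\alpha))=\gamma>\beta$, then $(u\nabla v)'_-((u\nabla v)^+(\beta))=\varphi$. (iv) If $u'_+(u^+(\alpha))=\varphi$ and $\lim_{y\to v^+(\alpha)+}v(y)=\lambda<\alpha$, then $(u\nabla v)'_+((u\nabla v)^+(\alpha))=\varphi$.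
   Context: A fuzzy number is a map $u:\mathbb{R}\to[0,1]$ such that, writing $[u]_\alpha=\{x:u(x)\ge\alpha\}$ for $\alpha\in(0,1]$ and $[u]_0=\overline{\{x:u(x)>0\}}$, the set $[u]_1$ is nonempty and each $[u]_\alpha=[u^-(\alpha),u^+(\alpha)]$, $\alpha\in[0,1]$, is a compact interval. $\mathcal{F}(\mathbb{R})$ is the set of all fuzzy numbers. The sup-min convolution is $(u\nabla v)(x)=\sup_{y\in\mathbb{R}}\min\{u(y),v(x-y)\}$; it is a fuzzy number with $[u\nabla v]_\alpha=[u^-(\alpha)+v^-(\alpha),u^+(\alpha)+v^+(\alpha)]$ for all $\alpha\in[0,1]$. $f'_-$ and $f'_+$ denote the (finite) left and right derivatives of a function $f:\mathbb{R}\to\mathbb{R}$. *)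

(* Defs.v *)
From HB Require Import structures.
From mathcomp Require Import all_boot all_order all_algebra.
From mathcomp Require Import all_classical all_reals all_analysis.

Set Implicit Arguments.
Unset Strict Implicit.
Unset Printing Implicit Defensive.

Import Order.TTheory GRing.Theory Num.Theory.
Import numFieldNormedType.Exports.

Local Open Scope classical_set_scope.
Local Open Scope ring_scope.

(* The level set [f]_a, meaningful for 0 <= a <= 1. *)
Definition level {R : realType} (f : R -> R) (a : R) : set R :=
  if a == 0 then closure [set x | 0 < f x] else [set x | a <= f x].

Record fuzzyNumber (R : realType) := FuzzyNumber {
  fuzzy_fun :> R -> R ;
  fuzzy_range : forall x, 0 <= fuzzy_fun x <= 1 ;
  fuzzy_core : level fuzzy_fun 1 !=set0 ;
  fuzzy_level : forall a, 0 <= a <= 1 ->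
    exists l r, l <= r /\ level fuzzy_fun a = `[l, r]%classic
}.

(* The endpoints f^-(a) and f^+(a).  They are defined for any function, so that
   they apply to a sup-min convolution directly; [fuzzy_levelE] shows that they
   are the endpoints of the level sets of a fuzzy number. *)
Definition lend {R : realType} (f : R -> R) (a : R) : R := inf (level f a).
Definition rend {R : realType} (f : R -> R) (a : R) : R := sup (level f a).

Lemma fuzzy_levelE (R : realType) (u : fuzzyNumber R) (a : R) :
  0 <= a <= 1 -> level u a = `[lend u a, rend u a]%classic.
Proof.
move=> /(fuzzy_level u) [l [r [lr E]]].
by rewrite /lend /rend E inf_itv ?bnd_simp// sup_itv ?bnd_simp.
Qed.

Definition supmin {R : realType} (f g : R -> R) (x : R) : R :=
  sup [set Num.min (f y) (g (x - y)) | y in [set: R]].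

(* [is_rderive f x l]: the right derivative of f at x exists (finitely) and is l;
   [is_lderive] is the same on the left. *)
Definition is_rderive {R : realType} (f : R -> R) (x l : R) : Prop :=
  (f y - f x) / (y - x) @[y --> x^'+] --> l.
Definition is_lderive {R : realType} (f : R -> R) (x l : R) : Prop :=
  (f y - f x) / (y - x) @[y --> x^'-] --> l.

(* Main.v *)
(* To the right of the core u and v are nonincreasing.  In a splitting
   x + y = s + (x + y - s), either s >= x or x + y - s > y, hence
     min (u x) (v y) <= (u nabla v) (x + y) <= max (u x) (v y).
   In (i) and (ii) let (x0, y0) be the base points; shifting x0 by p h and y0
   by q h with p = psi / (phi + psi), q = phi / (phi + psi), p + q = 1, makes
   both bounds have the slope phi p = psi q = (phi^-1 + psi^-1)^-1.  In (iii)
   and (iv) the jump of v at y0 gives (u nabla v) (x + y0) = u x for x near x0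
   on the relevant side. *)

Require Import Defs.
From HB Require Import structures.
From mathcomp Require Import all_boot all_order all_algebra.
From mathcomp Require Import all_classical all_reals all_analysis.
From mathcomp Require Import ring lra.
Import Order.TTheory GRing.Theory Num.Theory.
Import numFieldNormedType.Exports.
Local Open Scope classical_set_scope.
Local Open Scope ring_scope.

Set Implicit Arguments.
Unset Strict Implicit.

Lemma sup_max (R : realType) (A : set R) (m : R) :
  A m -> ubound A m -> sup A = m.
Proof.
move=> Am ubm; apply/eqP; rewrite eq_le; apply/andP; split.
  by apply: ge_sup => //; exists m.
by apply: ub_le_sup => //; exists m.
Qed.

Section fuzzy_numbers.
Variable R : realType.
Implicit Types (u v : fuzzyNumber R) (a b x y : R).

(** * Level sets, right endpoints and monotonicity of fuzzy numbers *)

Lemma fuzzy_ge0 u x : 0 <= u x.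
Proof. by have /andP[] := fuzzy_range u x. Qed.

Lemma fuzzy_le1 u x : u x <= 1.
Proof. by have /andP[] := fuzzy_range u x. Qed.

Lemma rend_level u a : 0 <= a <= 1 -> level u a (rend u a).
Proof.
move=> a01; have [l [r [lr E]]] := fuzzy_level u a01.
by rewrite /rend E sup_itv ?bnd_simp//= in_itv/= lexx lr.
Qed.

Lemma level_le_rend u a x : 0 <= a <= 1 -> level u a x -> x <= rend u a.
Proof. by move=> a01; rewrite fuzzy_levelE//= in_itv/= => /andP[]. Qed.

Lemma le_rend u a x : 0 < a <= 1 -> a <= u x -> x <= rend u a.
Proof.
move=> /andP[a0 a1] aux; apply: level_le_rend; first by rewrite ltW.
by rewrite /level gt_eqF.
Qed.

Lemma fuzzy_rend_ge u a : 0 <= a <= 1 -> a <= u (rend u a).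
Proof.
move=> a01; have := rend_level u a01; rewrite /level.
by have [-> _|//] := eqVneq a 0; rewrite fuzzy_ge0.
Qed.

Lemma fuzzy_gt_rend u a x : 0 <= a <= 1 -> rend u a < x -> u x <= a.
Proof.
move=> a01 xr; rewrite leNgt; apply/negP => aux.
suff /(level_le_rend a01) : level u a x by rewrite leNgt xr.
rewrite /level; have [a0|_] := eqVneq a 0; last exact: ltW.
by apply: subset_closure => /=; rewrite -a0.
Qed.

(** Past [rend u a] the values are at most [a], hence below [b] when [a < b], while [rend u a]
    itself reaches [b]. This carries the base points of (ii) and (iii) from level [beta] back to
    level [alpha]. *)
Lemma rend_plateau u a b :
  0 <= a <= b -> b <= u (rend u a) -> rend u b = rend u a.
Proof.
move=> /andP[a0 ab] bu; have b1 := le_trans bu (fuzzy_le1 u _).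
have [<-//|anb] := eqVneq a b.
have lab : a < b by rewrite lt_neqAle anb.
have b0 := le_lt_trans a0 lab.
apply/eqP; rewrite eq_le; apply/andP; split; last first.
  by apply: le_rend => //; rewrite b0.
rewrite leNgt; apply/negP => /fuzzy_gt_rend; rewrite a0 (le_trans ab b1) => /(_ isT).
by apply/negP; rewrite -ltNge (lt_le_trans lab)// fuzzy_rend_ge// (ltW b0).
Qed.

Lemma fuzzy_rend1 u : u (rend u 1) = 1.
Proof. by apply/eqP; rewrite eq_le fuzzy_le1 fuzzy_rend_ge// ler01 lexx. Qed.

Lemma rend1_le u a : 0 <= a <= 1 -> rend u 1 <= rend u a.
Proof.
move=> a01; apply: (@level_le_rend _ a) => //; rewrite /level.
case: ifPn => _ /=; last by rewrite fuzzy_rend1; case/andP: a01.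
by apply: subset_closure; rewrite /= fuzzy_rend1.
Qed.

Lemma rend1_lt u a : 0 <= a <= 1 -> u (rend u a) < 1 -> rend u 1 < rend u a.
Proof.
move=> a01 ua; rewrite lt_neqAle rend1_le// andbT.
by apply: contraTneq ua => <-; rewrite fuzzy_rend1 ltxx.
Qed.

Lemma fuzzy_nonincreasing u x y : rend u 1 <= x -> x <= y -> u y <= u x.
Proof.
(* Level [0] is a closure and not a superlevel set, so a zero value is treated apart. Otherwise the
   interval at height [u y] contains [rend u 1] and [y], hence also [x]. *)
move=> rx xy; have [->|uy0] := eqVneq (u y) 0; first exact: fuzzy_ge0.
have uy01 := fuzzy_range u y; have [l [r [lr E]]] := fuzzy_level u uy01.
have lE z : (u y <= u z) <-> (l <= z <= r).
  have -> : (u y <= u z) = level u (u y) z :> Prop.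
    by rewrite /level (negbTE uy0).
  by rewrite E /= in_itv.
have /lE/andP[lr1 _] : u y <= u (rend u 1) by rewrite fuzzy_rend1 fuzzy_le1.
have /lE/andP[_ yr] := lexx (u y).
by apply/lE; rewrite (le_trans lr1 rx) (le_trans xy yr).
Qed.

(** * Bounds on the sup-min convolution and its right endpoints *)

Lemma supmin_ge u v x y : Num.min (u x) (v y) <= supmin u v (x + y).
Proof.
apply: ub_le_sup; last by exists x => //; rewrite addrAC subrr add0r.
by exists 1 => _ [z _ <-]; rewrite ge_min fuzzy_le1.
Qed.

Lemma supmin_le u v x a :
  (forall y, Num.min (u y) (v (x - y)) <= a) -> supmin u v x <= a.
Proof.
move=> ua; apply: ge_sup; last by move=> _ [z _ <-].
by exists (Num.min (u 0) (v (x - 0))), 0.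
Qed.

Lemma supmin_le_max u v x y : rend u 1 <= x -> rend v 1 <= y ->
  supmin u v (x + y) <= Num.max (u x) (v y).
Proof.
move=> ux vy; apply: supmin_le => s; rewrite ge_min !le_max.
have [xs|sx] := leP x s; first by rewrite fuzzy_nonincreasing.
by rewrite (@fuzzy_nonincreasing v y) ?orbT//; lra.
Qed.

(** The splitting into [x] and [y] attains [u x]. Any other one moves right of [x], where [u] is no
    larger, or past [y], where [v] may have jumped down but stays below [u x]. *)
Lemma supmin_eql u v x y : rend u 1 <= x -> u x <= v y ->
  (forall t, y < t -> v t <= u x) -> supmin u v (x + y) = u x.
Proof.
move=> ux uv vu; apply/eqP; rewrite eq_le; apply/andP; split; last first.
  by rewrite -{1}(min_idPl uv) supmin_ge.
apply: supmin_le => s; rewrite ge_min.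
have [xs|sx] := leP x s; first by rewrite fuzzy_nonincreasing.
by rewrite vu ?orbT//; lra.
Qed.

Lemma level_supmin_rend u v a : 0 <= a <= 1 ->
  level (supmin u v) a (rend u a + rend v a).
Proof.
move=> a01; have := rend_level v a01; have := rend_level u a01.
rewrite /level; case: ifPn => _ /=; last first.
  by move=> ua va; apply: le_trans (supmin_ge _ _ _ _); rewrite le_min ua.
(* At level [0] the endpoints are closure points: points of positive value within [e / 2] of each
   add up to one within [e] of the sum. *)
move=> cu cv B /nbhs_ballP[e /= e0 eB].
have e2 : 0 < e / 2 by rewrite divr_gt0.
have [x [/= ux]] := cu _ (nbhsx_ballx _ _ e2).
have [y [/= vy]] := cv _ (nbhsx_ballx _ _ e2).
rewrite /ball/= => dy dx; exists (x + y); split => /=.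
  by apply: lt_le_trans (supmin_ge _ _ _ _); rewrite lt_min ux.
apply: eB; rewrite /ball/= opprD addrACA (le_lt_trans (ler_normD _ _))//.
by rewrite [e]splitr ltrD.
Qed.

Lemma rend_supmin u v a : 0 <= a <= 1 ->
  rend (supmin u v) a = rend u a + rend v a.
Proof.
move=> a01; have /andP[a0 a1] := a01.
apply: sup_max; first exact: level_supmin_rend.
have w_le x : rend u a + rend v a < x -> exists s t,
    [/\ rend u a < s, rend v a < t & supmin u v x <= Num.max (u s) (v t)].
  (* Half of the excess of [x] over the sum of the endpoints goes to each summand, so that both pass
     their endpoints. *)
  move=> rx; exists ((rend u a + (x - rend v a)) / 2).
  exists ((rend v a + (x - rend u a)) / 2); split; [lra|lra|].
  have ru := rend1_le u a01; have rv := rend1_le v a01.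
  rewrite [x in supmin _ _ x](_ : x = (rend u a + (x - rend v a)) / 2 +
    (rend v a + (x - rend u a)) / 2); last by field.
  by apply: supmin_le_max; lra.
rewrite /level; case: ifPn => [/eqP aE|an0].
  move=> z clz; apply: (@closed_le R (rend u a + rend v a)).
  apply: closureS clz => x /= wx; rewrite leNgt; apply/negP => /w_le[s [t [us vt]]].
  rewrite leNgt gt_max (le_lt_trans (fuzzy_gt_rend a01 us)) ?aE//.
  by rewrite (le_lt_trans (fuzzy_gt_rend a01 vt)) ?aE.
move=> x /= wx; rewrite leNgt; apply/negP => /w_le[s [t [us vt]]].
have a0' : 0 < a <= 1 by rewrite lt_neqAle eq_sym an0 a0 a1.
rewrite leNgt gt_max => /negP; apply; apply/andP; split;
  apply: (lt_le_trans _ wx); rewrite ltNge; apply/negP => /(le_rend a0').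
  by rewrite leNgt us.
by rewrite leNgt vt.
Qed.

(** * One-sided derivatives as error bounds *)

(* [s] is [1] for a right and [-1] for a left derivative. *)
Definition dderive (s : R) (f : R -> R) x l := forall e, 0 < e ->
  \forall h \near 0^'+, `|f (x + s * h) - f x - l * (s * h)| <= e * h.

(** Multiplying by the absolute value of [s * h], which is [h], clears the denominator and turns the
    limit of difference quotients into [dderive]. *)
Lemma quotient_dist (s h a l e : R) : s ^+ 2 = 1 -> 0 < h ->
  (`|l - a / (s * h)| <= e) = (`|a - l * (s * h)| <= e * h).
Proof.
move=> /eqP; rewrite sqrf_eq1 => s1 h0.
have s0 : s != 0 by case/orP: s1 => /eqP ->; rewrite ?oppr_eq0 oner_eq0.
have sn : `|s| = 1 by case/orP: s1 => /eqP ->; rewrite ?normrN normr1.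
rewrite -(ler_pM2r h0); congr (_ <= _).
transitivity (`|l - a / (s * h)| * `|s * h|).
  by rewrite normrM sn mul1r (gtr0_norm h0).
rewrite -normrM distrC; congr `|_|.
by field; rewrite s0 gt_eqF.
Qed.

Lemma is_rderiveP (f : R -> R) x l : is_rderive f x l <-> dderive 1 f x l.
Proof.
rewrite /is_rderive; split=> [/cvgrPdist_le fl e e0|fl].
  have /nbhs_right0P nfl := fl e e0.
  apply: (filterS2 _ _ (nbhs_right_gt 0) nfl) => h h0.
  rewrite [x + h - x]addrAC subrr add0r.
  have := quotient_dist (f (x + h) - f x) l e (expr1n _ 2) h0.
  by rewrite !mul1r => ->.
apply/cvgrPdist_le => e e0; apply/nbhs_right0P.
apply: (filterS2 _ _ (nbhs_right_gt 0) (fl e e0)) => h h0.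
rewrite [x + h - x]addrAC subrr add0r.
have := quotient_dist (f (x + h) - f x) l e (expr1n _ 2) h0.
by rewrite !mul1r => ->.
Qed.

Lemma is_lderiveP (f : R -> R) x l : is_lderive f x l <-> dderive (-1) f x l.
Proof.
rewrite /is_lderive; split=> [/cvgrPdist_le fl e e0|fl].
  have /nbhs_left0P nfl := fl e e0.
  apply: (filterS2 _ _ (nbhs_right_gt 0) nfl) => h h0.
  rewrite [x - h - x]addrAC subrr add0r.
  have N1 : (-1 : R) ^+ 2 = 1 by rewrite sqrrN expr1n.
  have := quotient_dist (f (x - h) - f x) l e N1 h0.
  by rewrite !mulN1r => ->.
apply/cvgrPdist_le => e e0; apply/nbhs_left0P.
apply: (filterS2 _ _ (nbhs_right_gt 0) (fl e e0)) => h h0.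
rewrite [x - h - x]addrAC subrr add0r.
have N1 : (-1 : R) ^+ 2 = 1 by rewrite sqrrN expr1n.
have := quotient_dist (f (x - h) - f x) l e N1 h0.
by rewrite !mulN1r => ->.
Qed.

Lemma dderive_eq (s : R) (f g : R -> R) x y l : dderive s f x l ->
  g y = f x -> (\forall h \near 0^'+, g (y + s * h) = f (x + s * h)) ->
  dderive s g y l.
Proof.
move=> fl gf nfg e /fl fle.
by apply: (filterS2 _ _ nfg fle) => h ->; rewrite gf.
Qed.

Lemma near0_right_scale (p : R) (P : set R) : 0 < p ->
  (\forall h \near 0^'+, P h) -> \forall h \near 0^'+, P (p * h).
Proof.
move=> p0 [e /= e0 eP]; exists (e / p); first by rewrite /= divr_gt0.
move=> h /=; rewrite sub0r normrN ltr_pdivlMr// => hp h0.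
apply: eP; last by rewrite mulr_gt0.
by rewrite /= sub0r normrN normrM (gtr0_norm p0) mulrC.
Qed.

Lemma dderive_cvg (s : R) (f : R -> R) x l : s ^+ 2 = 1 -> dderive s f x l ->
  f (x + s * h) @[h --> 0^'+] --> f x.
Proof.
move=> s1 fl; apply/cvgrPdist_le => e e0.
(* With tolerance [1] in the derivative, the increment of [f] is at most [1 + |l|] times [h]. *)
have c0 : 0 < 1 + `|l| by rewrite ltr_pwDl.
have hc := nbhs_right_lt (divr_gt0 e0 c0).
near=> h.
have h0 : 0 < h by near: h; exact: nbhs_right_gt.
have : h < e / (1 + `|l|) by near: h.
rewrite ltr_pdivlMr// mulrDr mulr1 => he.
have : `|f (x + s * h) - f x - l * (s * h)| <= 1 * h by near: h; exact: fl.
have : `|l * (s * h)| = h * `|l|.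
  have sn : `|s| = 1.
    by move: s1 => /eqP; rewrite sqrf_eq1 => /orP[] /eqP ->; rewrite ?normrN normr1.
  by rewrite !normrM sn mul1r (gtr0_norm h0) mulrC.
have := ler_normD (f (x + s * h) - f x - l * (s * h)) (l * (s * h)).
by rewrite subrK distrC; lra.
Unshelve. all: by end_near. Qed.

(** * The derivative of the convolution at points of equal height *)

(** The case [s = 1] serves (i) and [s = -1] serves (ii). The two eventual bounds keep the shifted
    points where [u] and [v] are nonincreasing, as the bound by the maximum requires. *)
Lemma dderive_supmin u v (s x y phi psi : R) :
  phi < 0 -> psi < 0 -> u x = v y ->
  dderive s u x phi -> dderive s v y psi ->
  rend u 1 <= x -> rend v 1 <= y ->
  (\forall h \near 0^'+, rend u 1 <= x + s * h) ->
  (\forall h \near 0^'+, rend v 1 <= y + s * h) ->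
  dderive s (supmin u v) (x + y) (phi^-1 + psi^-1)^-1.
Proof.
move=> phi0 psi0 uv du dv ux vy nux nvy e e0.
have pq0 : phi + psi < 0 by lra.
set p := psi / (phi + psi); set q := phi / (phi + psi).
have p0 : 0 < p by rewrite /p -mulrNN -invrN divr_gt0 ?oppr_gt0.
have q0 : 0 < q by rewrite /q -mulrNN -invrN divr_gt0 ?oppr_gt0.
have pq1 : p + q = 1 by rewrite /p /q; field; rewrite lt_eqF.
set L := (_ + _)^-1.
have Lp : phi * p = L by rewrite /L /p; field; rewrite !lt_eqF//; lra.
have Lq : psi * q = L by rewrite /L /q; field; rewrite !lt_eqF//; lra.
have w0 : supmin u v (x + y) = u x.
  apply: supmin_eql => //; first by rewrite uv.
  by move=> t /ltW yt; rewrite uv fuzzy_nonincreasing.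
near=> h.
have h0 : 0 < h by near: h; exact: nbhs_right_gt.
have ph : 0 <= p * h <= h by nra.
have qh : 0 <= q * h <= h by nra.
have hu : `|u (x + s * (p * h)) - u x - phi * (s * (p * h))| <= e * (p * h).
  by near: h; exact: (near0_right_scale p0 (du e e0)).
have hv : `|v (y + s * (q * h)) - v y - psi * (s * (q * h))| <= e * (q * h).
  by near: h; exact: (near0_right_scale q0 (dv e e0)).
have ru : rend u 1 <= x + s * (p * h).
  by near: h; exact: (near0_right_scale p0 nux).
have rv : rend v 1 <= y + s * (q * h).
  by near: h; exact: (near0_right_scale q0 nvy).
have hE : x + y + s * h = (x + s * (p * h)) + (y + s * (q * h)).
  by rewrite -[in LHS](mul1r h) -pq1; ring.
have := supmin_ge u v (x + s * (p * h)) (y + s * (q * h)).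
have := supmin_le_max ru rv.
rewrite -hE w0 le_max ge_min => up lo.
rewrite (_ : phi * (s * (p * h)) = L * (s * h)) in hu; last by rewrite -Lp; ring.
rewrite (_ : psi * (s * (q * h)) = L * (s * h)) in hv; last by rewrite -Lq; ring.
(* Both errors are at most [e * h], so whichever alternative of [lo] and of [up] holds gives the
   wanted bound. *)
have {}hu := le_trans hu (ler_wpM2l (ltW e0) (proj2 (andP ph))).
have {}hv := le_trans hv (ler_wpM2l (ltW e0) (proj2 (andP qh))).
move: hu hv; rewrite -uv !ler_norml => /andP[u1 u2] /andP[v1 v2].
apply/andP; split; [case/orP: lo|case/orP: up]; lra.
Unshelve. all: by end_near. Qed.

(** * Consequences of derivability at a right endpoint *)

(** A right derivative forces continuity from the right, and all values past the endpoint are at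
    most [a]; hence so is the value at it. *)
Lemma rderive_rend u a l : 0 <= a <= 1 -> dderive 1 u (rend u a) l ->
  u (rend u a) = a.
Proof.
move=> a01 du; apply/eqP; rewrite eq_le fuzzy_rend_ge// andbT.
apply: (cvgr_to_le (dderive_cvg (expr1n _ _) du)).
apply: (filterS _ (nbhs_right_gt 0)) => h h0.
by rewrite (fuzzy_gt_rend a01)// mul1r ltrDl.
Qed.

Lemma near_rend1_right u x : rend u 1 <= x ->
  \forall h \near 0^'+, rend u 1 <= x + 1 * h.
Proof.
move=> ux; apply: (filterS _ (nbhs_right_gt 0)) => h h0.
by rewrite mul1r (le_trans ux)// lerDl ltW.
Qed.

Lemma near_rend1_left u x : rend u 1 < x ->
  \forall h \near 0^'+, rend u 1 <= x + (-1) * h.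
Proof.
rewrite -subr_gt0 => ux; apply: (filterS _ (nbhs_right_lt ux)) => h hx.
by lra.
Qed.

Lemma lderive_rend1_lt u a l : 0 <= a <= 1 -> l < 0 ->
  dderive (-1) u (rend u a) l -> rend u 1 < rend u a.
Proof.
move=> a01 l0 du; apply: rend1_lt => //.
(* With tolerance [- l / 2], the value at some [h] to the left exceeds the value at the endpoint by
   at least [- l * h / 2], so the latter is below [1]. *)
have l2 : 0 < - l / 2 by lra.
have [h [/= h0]] := filter_ex (filterI (nbhs_right_gt (0 : R)) (du _ l2)).
have := fuzzy_le1 u (rend u a + -1 * h).
by rewrite ler_norml => + /andP[+ _]; nra.
Qed.

End fuzzy_numbers.

(** * The four one-sided derivative formulas *)

Theorem theorem4p3 (R : realType) (u v : fuzzyNumber R) (alpha : R)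
    (halpha : 0 <= alpha <= 1) :
  (* (i) *)
  (forall phi psi : R,
     is_rderive u (rend u alpha) phi -> phi < 0 ->
     is_rderive v (rend v alpha) psi -> psi < 0 ->
     is_rderive (supmin u v) (rend (supmin u v) alpha) (phi^-1 + psi^-1)^-1) /\
  (* (ii) *)
  (forall phi psi beta : R,
     is_lderive u (rend u alpha) phi -> phi < 0 ->
     is_lderive v (rend v alpha) psi -> psi < 0 ->
     u (rend u alpha) = beta -> v (rend v alpha) = beta ->
     is_lderive (supmin u v) (rend (supmin u v) beta) (phi^-1 + psi^-1)^-1) /\
  (* (iii) *)
  (forall phi beta gamma : R,
     is_lderive u (rend u alpha) phi ->
     u (rend u alpha) = beta ->
     v (rend v alpha) = gamma -> beta < gamma ->
     is_lderive (supmin u v) (rend (supmin u v) beta) phi) /\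
  (* (iv) *)
  (forall phi lambda : R,
     is_rderive u (rend u alpha) phi ->
     v y @[y --> (rend v alpha)^'+] --> lambda -> lambda < alpha ->
     is_rderive (supmin u v) (rend (supmin u v) alpha) phi).
Proof.
have /andP[a0 _] := halpha; split; [|split; [|split]].
- move=> phi psi /is_rderiveP du phi0 /is_rderiveP dv psi0.
  rewrite rend_supmin//; apply/is_rderiveP.
  have ru := rend1_le u halpha; have rv := rend1_le v halpha.
  apply: dderive_supmin => //; try exact: near_rend1_right.
  (* Right derivability makes both heights equal to [alpha]. *)
  by rewrite (rderive_rend _ du) ?(rderive_rend _ dv).
- move=> phi psi beta /is_lderiveP du phi0 /is_lderiveP dv psi0 ub vb.
  have b01 : 0 <= beta <= 1 by rewrite -ub fuzzy_range.
  have ab : 0 <= alpha <= beta by rewrite a0 -ub fuzzy_rend_ge.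
  have ru := lderive_rend1_lt halpha phi0 du.
  have rv := lderive_rend1_lt halpha psi0 dv.
  rewrite rend_supmin// !(rend_plateau ab) ?ub ?vb//; apply/is_lderiveP.
  apply: dderive_supmin => //; try exact: near_rend1_left; try exact: ltW.
  by rewrite ub vb.
- move=> phi beta gamma /is_lderiveP du ub vg bg.
  have b01 : 0 <= beta <= 1 by rewrite -ub fuzzy_range.
  have ab : 0 <= alpha <= beta by rewrite a0 -ub fuzzy_rend_ge.
  have ru : rend u 1 < rend u alpha.
    (* Here the endpoint lies off the core because [beta < gamma <= 1]. *)
    by apply: rend1_lt => //; rewrite ub (lt_le_trans bg)// -vg fuzzy_le1.
  rewrite rend_supmin// !(rend_plateau ab) ?ub ?vg// ?(ltW bg)//.
  have v_le t : rend v alpha < t -> v t <= beta.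
    by move=> /(fuzzy_gt_rend halpha) /le_trans; apply; case/andP: ab.
  have nu := near_rend1_left ru.
  apply/is_lderiveP; apply: (dderive_eq du).
    by apply: supmin_eql; rewrite ?ub ?vg ?(ltW ru) ?(ltW bg).
  (* By left continuity [u] is at most [gamma] just left of its endpoint, and by monotonicity at
     least [beta]: its values fall within the jump of [v]. *)
  have ul := cvgr_le _ (dderive_cvg _ du); rewrite ub in ul.
  near=> h; rewrite addrAC; have h0 : 0 < h by near: h; exact: nbhs_right_gt.
  have uh : beta <= u (rend u alpha + -1 * h).
    rewrite -ub; apply: fuzzy_nonincreasing; first by near: h.
    by rewrite mulN1r gerBl ltW.
  apply: supmin_eql; first by near: h.
    by rewrite vg; near: h; apply: ul; rewrite ?sqrrN ?expr1n.
  by move=> t /v_le /le_trans; apply.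
- move=> phi lambda /is_rderiveP du vl la.
  have ru := rend1_le u halpha; have rv := rend1_le v halpha.
  have uE := rderive_rend halpha du.
  have v_le t : rend v alpha < t -> v t <= lambda.
    (* Between [rend v alpha] and [t] the values of [v] are at least [v t], and so is their limit
       [lambda]. *)
    move=> vt; apply: (cvgr_to_ge vl).
    near=> y; apply: fuzzy_nonincreasing; last first.
      by apply: ltW; near: y; exact: nbhs_right_lt.
    apply: (le_trans rv); near: y; exact: nbhs_right_ge.
  rewrite rend_supmin//; apply/is_rderiveP; apply: (dderive_eq du).
    apply: supmin_eql; rewrite ?uE ?fuzzy_rend_ge//.
    by move=> t /v_le /le_trans; apply; exact: ltW.
  (* By right continuity [u] stays above [lambda] just right of its endpoint, and it is at most
     [alpha] there: again within the jump of [v]. *)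
  have ul := cvgr_ge _ (dderive_cvg _ du); rewrite uE in ul.
  near=> h; rewrite addrAC; have h0 : 0 < h by near: h; exact: nbhs_right_gt.
  apply: supmin_eql; first by rewrite mul1r (le_trans ru)// lerDl ltW.
    apply: le_trans (fuzzy_rend_ge v halpha).
    by apply: (fuzzy_gt_rend halpha); rewrite mul1r ltrDl.
  move=> t /v_le /le_trans; apply.
  by near: h; apply: ul; rewrite ?expr1n.
Unshelve. all: by end_near. Qed.
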